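(* Let $\mathbb K$ be a field, $R=\mathbb K[x_0,\dots,x_n]$, let $J\subset R$ be a quasi-stable monomial ideal and let $I\subset R$ be a homogeneous ideal generated by a $\mathcal P_J$-marked basis. If $J$ is Cohen-Macaulay (i.e. $R/J$ is Cohen-Macaulay), then $I$ is Cohen-Macaulay (i.e. $R/I$ is Cohen-Macaulay).
   Context: $R=\mathbb K[x_0,\dots,x_n]$ has the standard grading and variables ordered $x_0<x_1<\dots<x_n$. A term is a monomial $x^\alpha=x_0^{\alpha_0}\cdots x_n^{\alpha_n}$; for $x^\alpha\neq 1$, $\min(x^\alpha)$ (resp. $\max(x^\alpha)$) is the smallest (resp. largest) variable dividing $x^\alpha$. A monomial ideal $J$ is quasi-stable if for every term $x^\tau\in J$ and every variable $x_k>\min(x^\tau)$ there is an exponent $s_k$ with $\frac{x^\tau}{\min(x^\tau)}x_k^{s_k}\in J$. This holds if and only if $J$ has a (unique) Pommaret basis $\mathcal P_J$: a finite set of terms generating $J$ such that for every term $x^\tau\in J\setminus\mathcal P_J$ there is a unique $x^\sigma\in\mathcal P_J$ with $x^\tau=x^\delta x^\sigma$ and $\max(x^\delta)\le\min(x^\sigma)$. $\mathcal N(J)$ is the set of terms not in $J$, and $\mathcal N(J)_t$ its subset of terms of degree $t$. A $\mathcal P_J$-marked set is a set $\mathcal H=\{h_\alpha\}_{x^\alpha\in\mathcal P_J}\subset R$ of homogeneous polynomials, one for each $x^\alpha\in\mathcal P_J$, such that $x^\alpha$ (the head term of $h_\alpha$) occurs in $h_\alpha$ with coefficient $1$ and all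 other terms occurring in $h_\alpha$ belong to $\mathcal N(J)$. It is a $\mathcal P_J$-marked basis if $R_t=(\mathcal H)_t\oplus\langle\mathcal N(J)_t\rangle_{\mathbb K}$ for every degree $t$. *)

(* Defs.v *)
From mathcomp Require Import all_boot all_order all_algebra.
From mathcomp Require Export mpoly.

Set Implicit Arguments.
Unset Strict Implicit.
Unset Printing Implicit Defensive.

Import GRing.Theory.
Local Open Scope ring_scope.

(* Ideals are Prop-valued predicates on the ring, so that an ideal given by
   generators needs no decidable membership; the whole ring is allowed. *)
Section Ideals.
Variable R : comNzRingType.
Implicit Types (S I P : R -> Prop) (fs : seq R) (d : nat).

Definition is_ideal I : Prop :=
  [/\ I 0, forall f g, I f -> I g -> I (f + g) & forall a f, I f -> I (a * f)].

Definition ideal_gen S : R -> Prop := fun f =>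
  exists s : seq (R * R),
    (forall c, c \in s -> S c.2) /\ f = \sum_(c <- s) c.1 * c.2.

Definition prime_ideal P : Prop :=
  [/\ is_ideal P, ~ P 1 & forall f g, P (f * g) -> P f \/ P g].

(* A chain of length d of primes of R / I, i.e. of primes of R containing I. *)
Definition prime_chain I d (p : nat -> R -> Prop) : Prop :=
  (forall i, (i <= d)%N -> prime_ideal (p i) /\ (forall f, I f -> p i f)) /\
  (forall i, (i < d)%N ->
     (forall f, p i f -> p i.+1 f) /\ ~ (forall f, p i.+1 f -> p i f)).

(* The Krull dimension of the ring R / I is d. *)
Definition krull_dim_quo I d : Prop :=
  (exists p, prime_chain I d p) /\
  (forall e p, prime_chain I e p -> (e <= d)%N).

Definition ideal_add_seq I fs : R -> Prop :=
  ideal_gen (fun g => I g \/ g \in fs).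

(* fs is a regular sequence on R / I: its i-th entry is a nonzerodivisor modulo
   I and the previous entries, and R / (I + (fs)) is not zero. *)
Definition regular_seq_quo I fs : Prop :=
  (forall i g, (i < size fs)%N ->
     ideal_add_seq I (take i fs) (fs`_i * g) -> ideal_add_seq I (take i fs) g)
  /\ ~ ideal_add_seq I fs 1.

(* The maximal length of a regular sequence on R / I made of elements of the
   ideal m is d. *)
Definition depth_quo (m : R -> Prop) I d : Prop :=
  (exists fs, [/\ forall f, f \in fs -> m f, regular_seq_quo I fs
                & size fs = d]) /\
  (forall fs, (forall f, f \in fs -> m f) -> regular_seq_quo I fs ->
     (size fs <= d)%N).

End Ideals.

Section Marked.
Variables (K : fieldType) (n : nat).
Notation R := {mpoly K[n.+1]}.
Notation term := 'X_{1..n.+1}.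
Implicit Types (J I : R -> Prop) (P : seq term) (h : term -> R) (t s : term).

Definition irrelevant_ideal : R -> Prop :=
  ideal_gen (fun g => exists i : 'I_n.+1, g = 'X_i).

Definition homogeneous_ideal I : Prop :=
  is_ideal I /\ forall f d, I f -> I (pihomog mdeg d f).

(* For a homogeneous ideal I, R / I is Cohen-Macaulay when its depth (with
   respect to the irrelevant ideal) equals its Krull dimension.  The zero ring
   is Cohen-Macaulay by convention. *)
Definition cohen_macaulay I : Prop :=
  I 1 \/ exists d, depth_quo irrelevant_ideal I d /\ krull_dim_quo I d.

Definition monomial_ideal J : Prop :=
  exists T : term -> Prop,
    forall f, J f <-> ideal_gen (fun g => exists2 s, T s & g = 'X_[s]) f.

Definition is_min_var t (i : 'I_n.+1) : Prop :=
  (0 < t i)%N /\ forall j : 'I_n.+1, (0 < t j)%N -> (i <= j)%N.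

Definition quasi_stable J : Prop :=
  monomial_ideal J /\
  forall t (i k : 'I_n.+1), J 'X_[t] -> is_min_var t i -> (i < k)%N ->
    exists e : nat, J 'X_[(t - U_(i) + U_(k) *+ e)%MM].

(* max(x^t) <= min(x^s); holds vacuously when one of the terms is 1, so that
   {1} is the Pommaret basis of R itself. *)
Definition max_le_min t s : Prop :=
  forall i j : 'I_n.+1, (0 < t i)%N -> (0 < s j)%N -> (i <= j)%N.

Definition pommaret_basis J P : Prop :=
  (forall f, J f <-> ideal_gen (fun g => exists2 s, s \in P & g = 'X_[s]) f) /\
  (forall t, J 'X_[t] -> t \notin P ->
     exists! s, s \in P /\ exists d, t = (d + s)%MM /\ max_le_min d s).

(* Only the values of h on P matter: h s is the polynomial with head term s. *)
Definition marked_set J P h : Prop :=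
  forall s, s \in P ->
    [/\ h s \is homog mdeg, (h s)@_s = 1
      & forall t, t \in msupp (h s) -> t != s -> ~ J 'X_[t]].

Definition marked_ideal P h : R -> Prop :=
  ideal_gen (fun g => exists2 s, s \in P & g = h s).

(* The K-span of the terms of degree d outside J. *)
Definition normal_span J d : R -> Prop := fun v =>
  forall t, t \in msupp v -> mdeg t = d /\ ~ J 'X_[t].

(* R_d is the direct sum of (H)_d and <N(J)_d> for every d. *)
Definition marked_basis J P h : Prop :=
  marked_set J P h /\
  forall d,
    (forall f : R, f \is d.-homog ->
       exists u v, [/\ u \is d.-homog, marked_ideal P h u, normal_span J d v
                     & f = u + v]) /\
    (forall f : R, f \is d.-homog -> marked_ideal P h f -> normal_span J d f ->
       f = 0).

End Marked.

(* Main.v *)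
Require Import Defs.
From mathcomp Require Import all_boot all_order all_algebra.
From mathcomp Require Import zify ring.
From mathcomp Require classical_sets.
From Stdlib Require Import Classical.

Set Implicit Arguments.
Unset Strict Implicit.
Unset Printing Implicit Defensive.

Import GRing.Theory.
Local Open Scope ring_scope.

(* Both R/J and R/I have the terms outside J as a K-basis.  If R/J is
   Cohen-Macaulay of dimension D, then J contains powers of x_D, ..., x_n and
   its Pommaret basis only involves these variables, so both quotients are free
   of finite rank over K[x_0, ..., x_(D-1)]; hence x_0, ..., x_(D-1) is a regular
   sequence on R/I, and it remains to bound depth and dimension by D.
   Upper bounds are uniform: in a chain of ideals Q_0, ..., Q_e, with Q_e proper,
   where each Q_i contains an f_i that is a nonzerodivisor modulo Q_(i-1), the
   f_i are algebraically independent modulo Q_0, so e is at most the growth order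
   of R/Q_0.  Prime chains and regular sequences both give such chains, and so do
   the annihilators of a fixed element modulo the initial parts of a regular
   sequence; the latter bound depth R/J by the index of min(x^s) for every x^s in
   the Pommaret basis.  Conversely a regular sequence gives a chain of primes,
   by choosing primes downwards. *)

(** * Nonzerodivisors, regular sequences and chains of primes in a commutative ring *)

Section Ideals.
Variable R : comNzRingType.
Implicit Types (I Q S : R -> Prop) (f g u : R) (fs gs : seq R).

Definition nzd Q f : Prop := forall g, Q (f * g) -> Q g.

Definition ideal_add Q f : R -> Prop := fun g => exists a, Q (g - a * f).

Definition ideal_colon Q u : R -> Prop := fun g => Q (g * u).

(** The final quotient may vanish, unlike in [regular_seq_quo], so the notion survives extensions
    with a zero term; the recursion lets inductions change the base ideal. *)
Fixpoint weakly_regular Q fs : Prop :=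
  if fs is f :: fs' then nzd Q f /\ weakly_regular (ideal_add Q f) fs' else True.

Fixpoint nzd_chain Q fs : Prop :=
  if fs is f :: fs' then
    nzd Q f /\ exists Q', [/\ is_ideal Q', forall g, Q g -> Q' g, Q' f
                            & nzd_chain Q' fs']
  else ~ Q 1.

Lemma idealN Q f : is_ideal Q -> Q f -> Q (- f).
Proof. by case=> _ _ QM /(QM (-1)); rewrite mulN1r. Qed.

Lemma idealB Q f g : is_ideal Q -> Q f -> Q g -> Q (f - g).
Proof. by move=> iQ Qf Qg; case: (iQ) => _ QD _; apply: QD => //; apply: idealN. Qed.

Lemma ideal_sum Q (T : eqType) (r : seq T) (F : T -> R) :
  is_ideal Q -> (forall x, x \in r -> Q (F x)) -> Q (\sum_(x <- r) F x).
Proof.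
by case=> Q0 QD _ QF; rewrite big_seq; elim/big_ind: _.
Qed.

Lemma ideal_add_ideal Q f : is_ideal Q -> is_ideal (ideal_add Q f).
Proof.
move=> [Q0 QD QM]; split.
- by exists 0; rewrite mul0r subr0.
- move=> g h [a Qa] [b Qb]; exists (a + b).
  by rewrite mulrDl opprD addrACA; apply: QD.
- move=> c g [a Qa]; exists (c * a).
  by rewrite -mulrA -mulrBr; apply: QM.
Qed.

Lemma sub_ideal_add Q f g : Q g -> ideal_add Q f g.
Proof. by exists 0; rewrite mul0r subr0. Qed.

Lemma mem_ideal_add Q f : is_ideal Q -> ideal_add Q f f.
Proof. by case=> Q0 _ _; exists 1; rewrite mul1r subrr. Qed.

Lemma ideal_colon_ideal Q u : is_ideal Q -> is_ideal (ideal_colon Q u).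
Proof.
rewrite /ideal_colon => -[Q0 QD QM]; split; first by rewrite mul0r.
- by move=> f g Qf Qg; rewrite mulrDl; apply: QD.
- by move=> a f Qf; rewrite -mulrA; apply: QM.
Qed.

Lemma weakly_regular_eq fs Q Q' :
  (forall g, Q g <-> Q' g) -> weakly_regular Q fs -> weakly_regular Q' fs.
Proof.
elim: fs Q Q' => //= f fs IH Q Q' eQ [nf rfs]; split.
  by move=> g /eQ/nf/eQ.
by apply: IH rfs => g; split=> -[a /eQ Qa]; exists a.
Qed.

Lemma weakly_regular_full fs Q : (forall g, Q g) -> weakly_regular Q fs.
Proof.
elim: fs Q => //= f fs IH Q QT; split; first by move.
by apply: IH => g; exists 0.
Qed.

(* The sequence 0 -> R/(Q : u) -> R/Q -> R/(Q + u) -> 0 is exact, and stays so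
   modulo each f in turn. *)
Lemma weakly_regular_extension fs Q u : is_ideal Q ->
  weakly_regular (ideal_colon Q u) fs -> weakly_regular (ideal_add Q u) fs ->
  weakly_regular Q fs.
Proof.
elim: fs Q => //= f fs IH Q iQ [n1 r1] [n2 r2].
have [Q0 QD QM] := iQ.
split.
  move=> g Qfg; have [a Qa] : ideal_add Q u g.
    by apply: n2; apply: sub_ideal_add.
  have /n1 : ideal_colon Q u (f * a).
    rewrite /ideal_colon (_ : _ * _ = f * g - f * (g - a * u)); last by ring.
    by apply: idealB => //; apply: QM.
  by move=> Qau; rewrite -[g](subrK (a * u)); apply: QD.
apply: IH; first exact: ideal_add_ideal.
- apply: weakly_regular_eq r1 => g; split.
    case=> a Qa; exists (a * u); move: Qa; rewrite /ideal_colon mulrBl.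
    by rewrite mulrAC.
  case=> h Qh.
  have [a Qa] : ideal_add Q u h.
    apply: n2; exists g; rewrite (_ : _ - _ = - (g * u - h * f)); last by ring.
    exact: idealN.
  exists a; rewrite /ideal_colon.
  rewrite (_ : _ * _ = (g * u - h * f) + f * (h - a * u)); last by ring.
  by apply: QD => //; apply: QM.
- apply: weakly_regular_eq r2 => g; split=> -[a [b Qab]]; exists b, a;
    by rewrite addrAC.
Qed.

Lemma nzdX Q f k : nzd Q f -> nzd Q (f ^+ k).
Proof.
move=> nf; elim: k => [|k IH] g; first by rewrite mul1r.
by rewrite exprS -mulrA => /nf/IH.
Qed.

(** Induction on [k] by the extension along [f ^+ k]: its annihilator modulo [Q + (f ^+ k.+1)] is
    [Q + (f)], and killing it leaves [Q + (f ^+ k)]. *)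
Lemma weakly_regular_powl Q f fs k : is_ideal Q -> nzd Q f ->
  weakly_regular (ideal_add Q f) fs -> weakly_regular (ideal_add Q (f ^+ k)) fs.
Proof.
move=> iQ nf rfs; have [Q0 QD QM] := iQ.
elim: k => [|k IH].
  (* For [k = 0] the element [f ^+ 0 = 1] makes the quotient zero. *)
  by apply: weakly_regular_full => g; exists g; rewrite mulr1 subrr.
apply: (@weakly_regular_extension _ _ (f ^+ k)); first exact: ideal_add_ideal.
- apply: weakly_regular_eq rfs => g; split; case=> a Qa; exists a.
    rewrite (_ : _ - _ = f ^+ k * (g - a * f)); first exact: QM.
    by rewrite exprS; ring.
  apply: (@nzdX _ _ k nf); rewrite (_ : _ * _ = g * f ^+ k - a * f ^+ k.+1) //.
  by rewrite exprSr; ring.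
- apply: weakly_regular_eq IH => g; split.
    by move=> [a Qa]; exists a; apply: sub_ideal_add.
  move=> [a [b Qab]]; exists (a + b * f).
  by rewrite (_ : _ - _ = g - a * f ^+ k - b * f ^+ k.+1) // exprSr; ring.
Qed.

Lemma weakly_regular_pow Q fs k : is_ideal Q ->
  weakly_regular Q fs -> weakly_regular Q [seq f ^+ k | f <- fs].
Proof.
elim: fs Q => //= f fs IH Q iQ [nf rfs]; split; first exact: nzdX.
by apply: weakly_regular_powl => //; apply: IH => //; apply: ideal_add_ideal.
Qed.

Lemma foldl_ideal_add Q fs :
  is_ideal Q -> is_ideal (foldl ideal_add Q fs).
Proof. by elim: fs Q => //= f fs IH Q iQ; apply/IH/ideal_add_ideal. Qed.

Lemma foldl_ideal_add_min Q Q' fs g : is_ideal Q' -> (forall g, Q g -> Q' g) ->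
  (forall f, f \in fs -> Q' f) -> foldl ideal_add Q fs g -> Q' g.
Proof.
move=> [_ QD QM]; elim: fs Q => [|f fs IH] Q sQ sf; first exact: sQ.
move=> /=; apply: IH => [h [a /sQ Qa]|h hfs]; last by apply: sf; rewrite inE hfs orbT.
by rewrite -[h](subrK (a * f)); apply: QD => //; apply/QM/sf/mem_head.
Qed.

Lemma ideal_gen_ideal S : is_ideal (ideal_gen S).
Proof.
split.
- by exists [::]; rewrite big_nil.
- move=> f g [s [Ss ->]] [t [St ->]]; exists (s ++ t); rewrite big_cat; split=> //.
  by move=> c; rewrite mem_cat => /orP[/Ss|/St].
- move=> a f [s [Ss ->]]; exists [seq (a * c.1, c.2) | c <- s]; split.
    by move=> c /mapP[d /Ss Sd ->].
  by rewrite big_map mulr_sumr; apply: eq_bigr => c _; rewrite mulrA.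
Qed.

Lemma mem_ideal_gen S f : S f -> ideal_gen S f.
Proof.
move=> Sf; exists [:: (1, f)]; rewrite big_seq1 mul1r; split=> //.
by move=> c; rewrite inE => /eqP->.
Qed.

Lemma ideal_gen_min S Q f :
  is_ideal Q -> (forall g, S g -> Q g) -> ideal_gen S f -> Q f.
Proof.
move=> iQ sS [s [Ss ->]]; apply: ideal_sum => // c /Ss/sS.
by case: iQ => _ _; apply.
Qed.

Lemma ideal_add_seqE Q fs g : is_ideal Q ->
  ideal_add_seq Q fs g <-> foldl ideal_add Q fs g.
Proof.
move=> iQ; split.
  apply: ideal_gen_min; first exact: foldl_ideal_add.
  have sub : forall (gs : seq R) Q' h, Q' h -> foldl ideal_add Q' gs h.
    elim=> //= f gs IH Q' h Qh; apply: IH; exact: sub_ideal_add.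
  move=> h [|]; first exact: sub.
  elim: fs Q iQ {g} => //= f fs IH Q iQ; rewrite inE => /orP[/eqP->|].
    by apply/sub/mem_ideal_add.
  by apply: IH; apply: ideal_add_ideal.
apply: foldl_ideal_add_min; first exact: ideal_gen_ideal.
  by move=> h Qh; apply: mem_ideal_gen; left.
by move=> h hfs; apply: mem_ideal_gen; right.
Qed.

Lemma regular_seq_quoE Q fs : is_ideal Q ->
  regular_seq_quo Q fs <-> weakly_regular Q fs /\ ~ foldl ideal_add Q fs 1.
Proof.
move=> iQ; rewrite /regular_seq_quo (ideal_add_seqE fs 1 iQ).
suff -> : (forall i g, (i < size fs)%N ->
     ideal_add_seq Q (take i fs) (fs`_i * g) -> ideal_add_seq Q (take i fs) g)
   <-> weakly_regular Q fs by [].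
elim: fs Q iQ => //= f fs IH Q iQ; split.
  move=> H; split.
    by move=> g /(ideal_add_seqE [::] _ iQ)/(H 0 g isT)/(ideal_add_seqE [::] _ iQ).
  have iQf := ideal_add_ideal f iQ.
  apply/IH => // i g li /(ideal_add_seqE _ _ iQf) Qg.
  apply/(ideal_add_seqE _ _ iQf)/(ideal_add_seqE (f :: take i fs) _ iQ).
  by apply: (H i.+1 g) => //; apply/(ideal_add_seqE (f :: take i fs) _ iQ).
move=> [nf]; have iQf := ideal_add_ideal f iQ.
move=> /(IH _ iQf) H [|i] g li /(ideal_add_seqE _ _ iQ) Qg;
  apply/(ideal_add_seqE _ _ iQ) => /=; first exact: nf.
by apply/(ideal_add_seqE _ _ iQf)/H/(ideal_add_seqE _ _ iQf).
Qed.

(** Each entry stays a nonzerodivisor modulo the colon ideal by [u], and the last colon ideal is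
    proper because [u] lies outside the full ideal. *)
Lemma weakly_regular_nzd_chain Q fs u : is_ideal Q ->
  weakly_regular Q fs -> ~ foldl ideal_add Q fs u -> nzd_chain (ideal_colon Q u) fs.
Proof.
elim: fs Q => [|f fs IH] Q iQ /=; first by rewrite /ideal_colon mul1r.
move=> [nf rfs] nu; split; first by move=> g; rewrite /ideal_colon -mulrA => /nf.
have iQf := ideal_add_ideal f iQ.
exists (ideal_colon (ideal_add Q f) u); split; first exact: ideal_colon_ideal.
- by move=> g Qg; apply: sub_ideal_add.
- by rewrite /ideal_colon mulrC; case: iQf => _ _; apply; apply: mem_ideal_add.
- exact: IH.
Qed.

Lemma prime_chain_nzd_chain Q d p : prime_chain Q d p ->
  exists2 fs, size fs = d & nzd_chain (p 0%N) fs.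
Proof.
elim: d p Q => [|d IH] p Q [pr st].
  by exists [::] => //=; have [[]] := pr 0%N isT.
have [fs sfs cfs] : exists2 fs, size fs = d & nzd_chain (p 1%N) fs.
  by apply: (IH (fun i => p i.+1) Q); split=> i li; [apply: pr|apply: st].
have [s01 n10] := st 0%N isT.
have [f nf] := not_all_ex_not _ _ n10; have [p1f np0f] := imply_to_and _ _ nf.
exists (f :: fs) => /=; first by rewrite sfs.
have [[_ _ pp] _] := pr 0%N isT; have [[i1 _ _] _] := pr 1%N isT.
by split; [move=> g /pp[] | exists (p 1%N); split].
Qed.

(** Krull's argument: an ideal maximal among those containing [Q] and missing the multiplicative set
    [S] is prime. *)
Lemma exists_prime_disjoint Q S : is_ideal Q ->
  S 1 -> (forall f g, S f -> S g -> S (f * g)) -> (forall f, S f -> ~ Q f) ->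
  exists p, [/\ prime_ideal p, forall f, Q f -> p f & forall f, S f -> ~ p f].
Proof.
move=> iQ S1 SM SQ.
(* The empty set is admitted because it is the union of the empty chain. *)
pose good A := (exists x, A x) ->
  [/\ is_ideal A, forall f, Q f -> A f & forall f, S f -> ~ A f].
have [] := @classical_sets.Zorn_bigcup R good.
  move=> F goodF totF [x [X FX Xx]].
  have [[X0 _ _] QX _] := goodF _ FX (ex_intro _ _ Xx); split.
  - split; first by exists X.
    + move=> f g [Y FY Yf] [Z FZ Zg].
      have [[_ YD _] _ _] := goodF _ FY (ex_intro _ _ Yf).
      have [[_ ZD _] _ _] := goodF _ FZ (ex_intro _ _ Zg).
      case: (totF _ _ FY FZ) => sYZ; [exists Z|exists Y] => //.
        by apply: ZD => //; apply: sYZ.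
      by apply: YD => //; apply: sYZ.
    + move=> a f [Y FY Yf]; exists Y => //.
      by have [[_ _ YM] _ _] := goodF _ FY (ex_intro _ _ Yf); apply: YM.
  - by move=> f /QX Xf; exists X.
  - move=> f Sf [Y FY Yf].
    by have [_ _ /(_ f Sf)] := goodF _ FY (ex_intro _ _ Yf).
move=> A [goodA maxA].
have A0 : exists x, A x.
  apply: NNPP => nA; apply: (maxA Q) => //; split.
    by move=> x Ax; case: nA; exists x.
  by move=> sQA; apply: nA; exists 0; apply: sQA; case: iQ.
have [iA QA SA] := goodA A0; have [_ AD AM] := iA.
have meet f : ~ A f -> exists2 s, S s & ideal_add A f s.
  move=> nAf; apply: NNPP => nS; apply: (maxA (ideal_add A f)).
    split; first by move=> g; apply: sub_ideal_add.
    by move=> sA; apply/nAf/sA/mem_ideal_add.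
  move=> _; split; first exact: ideal_add_ideal.
    by move=> g /QA; apply: sub_ideal_add.
  by move=> s Ss As; apply: nS; exists s.
exists A; split=> //; split=> //; first exact: SA.
move=> f g Afg; apply: NNPP => /not_or_and[/meet[s Ss [a Aa]] /meet[t St [b Ab]]].
apply: (SA _ (SM _ _ Ss St)).
rewrite (_ : s * t = t * (s - a * f) + (a * f) * (t - b * g) + (a * b) * (f * g));
  last by ring.
by apply: (AD); [apply: AD|]; apply: AM.
Qed.

(* Prime avoidance replaces the usual minimal primes: a prime above Q avoiding
   all f ^+ k * s with s outside p' is contained in p' and misses f. *)
Lemma nzd_prime_below Q p' f : is_ideal Q -> nzd Q f -> prime_ideal p' ->
  (forall g, Q g -> p' g) ->
  exists p, [/\ prime_ideal p, forall g, Q g -> p g, forall g, p g -> p' g & ~ p f].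
Proof.
move=> iQ nf [_ p'1 p'M] Qp'.
pose S g := exists k s, ~ p' s /\ g = f ^+ k * s.
have [|||p [pp Qp Sp]] := @exists_prime_disjoint Q S iQ.
- by exists 0%N, 1; rewrite mulr1.
- move=> _ _ [k [s [ns ->]]] [l [t [nt ->]]]; exists (k + l)%N, (s * t).
  by split; [case/p'M|rewrite exprD mulrACA].
- by move=> _ [k [s [ns ->]]] /(nzdX nf)/Qp'.
exists p; split=> //.
  move=> g pg; apply: NNPP => ng; apply: (Sp g) => //.
  by exists 0%N, g; rewrite mul1r.
by apply: Sp; exists 1%N, 1; rewrite mulr1.
Qed.

(** Below the first prime of a chain above [Q + (f)] there is a prime over [Q] missing [f]; as [f]
    lies in the former, the new inclusion is strict. *)
Lemma weakly_regular_prime_chain Q fs : is_ideal Q -> weakly_regular Q fs ->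
  ~ foldl ideal_add Q fs 1 -> exists p, prime_chain Q (size fs) p.
Proof.
elim: fs Q => [|f fs IH] Q iQ /=.
  move=> _ Q1; have [|||p [pp Qp _]] := @exists_prime_disjoint Q (eq^~ 1) iQ => //.
  - by move=> f g -> ->; rewrite mulr1.
  - by move=> f ->.
  by exists (fun=> p).
move=> [nf rfs] n1; have iQf := ideal_add_ideal f iQ.
have [p [pp st]] := IH _ iQf rfs n1.
have [pp0 Qp0] := pp 0%N isT.
have [|q [qq Qq qp0 nqf]] := nzd_prime_below iQ nf pp0.
  by move=> g Qg; apply/Qp0/sub_ideal_add.
exists (fun i => if i is j.+1 then p j else q); split=> -[|i] li //.
- have [ppi Qpi] := pp i li; split=> // g Qg.
  by apply/Qpi/sub_ideal_add.
- by split=> // /(_ f) pq; apply/nqf/pq/Qp0/mem_ideal_add.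
- exact: st.
Qed.

End Ideals.

(** * Growth of quotients of a polynomial ring, and the resulting bounds on chains *)

Section Dimension.
Variables (K : fieldType) (n : nat).
Notation R := {mpoly K[n]}.
Implicit Types (Q : R -> Prop) (f g v : R) (fs r : seq R) (t : 'X_{1..n}).

Definition independent_mod Q r : Prop := forall c : nat -> K,
  Q (\sum_(i < size r) c i *: r`_i) -> forall i, (i < size r)%N -> c i = 0.

(** Since reduction does not raise the degree, polynomials of degree at most [L] fall into a space
    of dimension O(L^d) modulo [Q]. *)
Definition spans_quo Q d b : Prop := forall f, exists v, Q (f - v) /\
  forall t, t \in msupp v ->
    (mdeg t < msize f)%N /\ forall i : 'I_n, (d <= i)%N -> (t i < b)%N.

Lemma idealZ Q c f : is_ideal Q -> Q f -> Q (c *: f).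
Proof. by case=> _ _ QM Qf; rewrite -mul_mpolyC; apply: QM. Qed.

(** Modulo [Q'] the multiples of [f] vanish, which kills the coefficients on [r]; then [f] is
    cancelled modulo [Q]. *)
Lemma independent_mod_cat Q Q' f r r' :
  is_ideal Q' -> (forall g, Q g -> Q' g) -> Q' f -> nzd Q f ->
  independent_mod Q' r -> independent_mod Q r' ->
  independent_mod Q (r ++ [seq f * g | g <- r']).
Proof.
move=> iQ' sQ Q'f nf ir ir' c; rewrite size_cat size_map big_split_ord /=.
rewrite (eq_bigr (fun i : 'I__ => c i *: r`_i)); last first.
  by move=> i _; rewrite nth_cat ltn_ord.
rewrite [X in _ + X](_ : _ = f * \sum_(i < size r') c (size r + i)%N *: r'`_i).
  2: rewrite mulr_sumr; apply: eq_bigr => i _.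
  2: by rewrite nth_cat ltnNge leq_addr addKn (nth_map 0) // -scalerAr.
move=> Qs; have cr : forall i, (i < size r)%N -> c i = 0.
  apply: ir.
  rewrite -[X in Q' X](addrK (f * \sum_(i < size r') c (size r + i)%N *: r'`_i)).
  apply: idealB => //; first exact: sQ.
  by rewrite mulrC; case: iQ' => _ _; apply.
rewrite big1 ?add0r in Qs; last by move=> i _; rewrite cr ?scale0r.
move=> i li; case: (ltnP i (size r)) => [/cr//|ri].
rewrite -(subnKC ri); apply: (ir' (fun i => c (size r + i)%N)); first exact: nf.
by rewrite ltn_subLR.
Qed.

(** The witnesses are the products of powers of the entries with all exponents below [N], so their
    degrees are linear in [N]. *)
Lemma nzd_chain_independent Q fs : is_ideal Q -> nzd_chain Q fs ->
  exists a, forall N, exists r, [/\ independent_mod Q r, size r = (N ^ size fs)%N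
    & forall g, g \in r -> (msize g <= a * N + 1)%N].
Proof.
elim: fs Q => [|f fs IH] Q iQ /=.
  move=> nQ1; exists 0%N => N; exists [:: 1]; split=> //=.
  - move=> c; rewrite big_ord1 /= => Qc [|//] _.
    apply: contra_not_eq nQ1 => c0; by have := idealZ (c 0%N)^-1 iQ Qc; rewrite scalerK.
  - by move=> g; rewrite inE => /eqP->; rewrite msize1.
move=> [nf [Q' [iQ' sQ Q'f /(IH _ iQ')[a Ha]]]].
exists (a + (msize f).+1)%N => N; have [r' [ir' sr' dr']] := Ha N.
have /(_ N)[r [ir sr dr]] : forall k, exists r, [/\ independent_mod Q r,
    size r = (k * N ^ size fs)%N
    & forall g, g \in r -> (msize g <= a * N + k * (msize f).+1 + 1)%N].
  elim=> [|k [r [ir sr dr]]]; first by exists [::].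
  exists (r' ++ [seq f * g | g <- r]); split.
  - exact: independent_mod_cat ir' ir.
  - by rewrite size_cat size_map sr' sr mulSn.
  - move=> g; rewrite mem_cat => /orP[/dr'|/mapP[h /dr dh ->]]; first by lia.
    by have := msizeM_le f h; lia.
exists r; split=> //; first by rewrite sr expnS.
by move=> g /dr; lia.
Qed.

(** With more elements than terms, the coefficient matrix of the reductions has a nonzero left
    kernel vector, which is a relation modulo [Q]. *)
Lemma independent_mod_size Q r (ts : seq 'X_{1..n}) :
  is_ideal Q -> independent_mod Q r ->
  (forall g, g \in r -> exists v, Q (g - v) /\ {subset msupp v <= ts}) ->
  (size r <= size ts)%N.
Proof.
move=> iQ ir sp; rewrite leqNgt; apply/negP => ltrs.
have /fin_all_exists[v vP] : forall i : 'I_(size r), exists v,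
    Q (r`_i - v) /\ {subset msupp v <= ts} by move=> i; apply/sp/mem_nth.
pose A := \matrix_(i < size r, j < size ts) (v i)@_(nth 0%MM ts j).
have kerA : kermx A != 0.
  rewrite -mxrank_eq0 mxrank_ker subn_eq0 -ltnNge.
  by apply: leq_ltn_trans (rank_leq_col A) _.
pose c := nz_row (kermx A).
have cA : c *m A = 0 by apply/sub_kermxP/nz_row_sub.
have cv : \sum_i c 0 i *: v i = 0.
  apply/mpolyP => t; rewrite mcoeff0 raddf_sum /=.
  have [/(nthP 0%MM)[j lj <-]|nts] := boolP (t \in ts).
    have := congr1 (fun B : 'rV_(size ts) => B 0 (Ordinal lj)) cA.
    rewrite !mxE => {2}<-; apply: eq_bigr => i _.
    by rewrite mcoeffZ mxE.
  apply: big1 => i _; rewrite mcoeffZ memN_msupp_eq0 ?mulr0 //.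
  by apply: contra nts; apply: (vP i).2.
suff c0 : c = 0 by move: kerA; rewrite -nz_row_eq0 -/c c0 eqxx.
apply/rowP => i; rewrite mxE.
pose c' k := oapp (c 0) 0 (insub k : option 'I_(size r)).
have c'E (j : 'I_(size r)) : c' j = c 0 j by rewrite /c' valK.
rewrite -c'E; apply: ir => //.
under eq_bigr do rewrite c'E.
rewrite -[X in Q X]subr0 -[X in _ - X]cv -sumrB; apply: ideal_sum => // j _.
by rewrite -scalerBr; apply: idealZ => //; case: (vP j).
Qed.

Lemma bounded_terms d b L : exists2 ts : seq 'X_{1..n},
  size ts = (L.+1 ^ d * b.+1 ^ n)%N
  & forall t, (mdeg t <= L)%N -> (forall i : 'I_n, (d <= i)%N -> (t i <= b)%N) ->
    t \in ts.
Proof.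
(* The second function is defined on all variables although it is read only from index [d] on,
   whence the crude factor [b.+1 ^ n]. *)
pose F := ({ffun 'I_d -> 'I_L.+1} * {ffun 'I_n -> 'I_b.+1})%type.
pose T (p : F) := [multinom
  (if insub (i : nat) is Some j then p.1 j : nat else p.2 i : nat) | i < n].
exists [seq T p | p <- enum {: F}].
  by rewrite size_map -cardE card_prod !card_ffun !card_ord.
move=> t tL tb; pose p1 := [ffun j : 'I_d => inord (nth 0%N t j) : 'I_L.+1].
pose p2 := [ffun i : 'I_n => inord (t i) : 'I_b.+1].
apply/mapP; exists (p1, p2); first by rewrite mem_enum.
apply/mnmP => i; rewrite mnmE /=; case: insubP => [j _ ji|].
  rewrite ffunE ji -mnm_nth inordK // ltnS; apply: leq_trans tL.
  by rewrite mdegE (bigD1 i) //= leq_addr.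
by rewrite -leqNgt => di; rewrite ffunE inordK // ltnS tb.
Qed.

Lemma nzd_chain_bound Q d b fs :
  is_ideal Q -> spans_quo Q d b -> nzd_chain Q fs -> (size fs <= d)%N.
Proof.
move=> iQ sp /(nzd_chain_independent iQ)[a Ha]; rewrite leqNgt; apply/negP => ltd.
(* For the degree bound [L = a * N + 1], [L.+1 <= (a + 2) * N] leaves at most [C * N ^ d] terms, and
   [N = C.+1] makes this less than [N ^ d.+1]. *)
pose C := ((a + 2) ^ d * b.+1 ^ n)%N; pose N := C.+1.
have [r [ir sr dr]] := Ha N.
have [ts sts tsP] := bounded_terms d b (a * N + 1).
have /(leq_trans _) le_ts : (size r <= size ts)%N.
  apply: independent_mod_size ir _ => // g /dr dg.
  have [v [Qv vP]] := sp g; exists v; split=> // t /vP[tg tb].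
  apply: tsP; first exact: leq_trans (ltnW tg) dg.
  by move=> i /tb/ltnW.
have : (N ^ d.+1 <= C * N ^ d)%N.
  apply: (@leq_trans (size ts)).
    by apply: le_ts; rewrite sr leq_pexp2l.
  rewrite sts /C mulnAC -expnMn leq_mul2r; apply/orP; right.
  by case: (d) => // d'; rewrite leq_exp2r // /N; lia.
by rewrite expnS leq_pmul2r ?expn_gt0 // ltnn.
Qed.

Lemma prime_chain_bound Q d b e p : spans_quo Q d b -> prime_chain Q e p ->
  (e <= d)%N.
Proof.
move=> sp cp; have [fs <- cfs] := prime_chain_nzd_chain cp.
have [[ip _ _] Qp] := cp.1 0%N isT.
apply: (@nzd_chain_bound _ d b _ ip _ cfs) => f.
by have [v [/Qp pv vP]] := sp f; exists v.
Qed.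

Lemma regular_seq_bound Q d b fs : is_ideal Q -> spans_quo Q d b ->
  regular_seq_quo Q fs -> (size fs <= d)%N.
Proof.
move=> iQ sp /(regular_seq_quoE _ iQ)[rfs /(weakly_regular_nzd_chain iQ rfs)].
apply: (@nzd_chain_bound _ d b) => [|f]; first exact: ideal_colon_ideal.
by have [v [Qv vP]] := sp f; exists v; rewrite /ideal_colon mulr1.
Qed.

End Dimension.

(** * Polynomials described by their supports, and ideals containing powers of variables *)

Section Supports.
Variables (K : fieldType) (n : nat).
Notation R := {mpoly K[n]}.
Notation term := 'X_{1..n}.
Implicit Types (I Q : R -> Prop) (T N : term -> Prop) (f g v : R) (s t : term).

Definition support_in T f : Prop := forall t, t \in msupp f -> T t.

(** For an ideal [I], the classes of the terms in [N] form a [K]-basis of R/I. *)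
Definition normal_complement I N : Prop :=
  (forall f, exists v, I (f - v) /\ support_in N v) /\
  (forall v, I v -> support_in N v -> v = 0).

Definition variables d : seq R := [seq 'X_i | i <- take d (enum 'I_n)].

Lemma support_in0 T : support_in T 0.
Proof. by move=> t; rewrite msupp0. Qed.

Lemma support_inD T f g :
  support_in T f -> support_in T g -> support_in T (f + g).
Proof.
by move=> Tf Tg t /msuppD_le; rewrite mem_cat => /orP[/Tf|/Tg].
Qed.

Lemma support_inB T f g :
  support_in T f -> support_in T g -> support_in T (f - g).
Proof.
by move=> Tf Tg t /msuppB_le; rewrite mem_cat => /orP[/Tf|/Tg].
Qed.

Lemma support_inM T1 T2 T f g : (forall s t, T1 s -> T2 t -> T (s + t)%MM) ->
  support_in T1 f -> support_in T2 g -> support_in T (f * g).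
Proof.
move=> TM Tf Tg t /msuppM_le/allpairsP[[s1 s2] /= [/Tf T1s /Tg T2s ->]].
exact: TM.
Qed.

Lemma support_inX T t : T t -> support_in T 'X_[t].
Proof. by move=> Tt s; rewrite msuppX inE => /eqP->. Qed.

Lemma support_inZX T c t : T t -> support_in T (c *: 'X_[t]).
Proof. by move=> Tt s /msuppZ_le; apply: support_inX. Qed.

Lemma support_in_ideal T :
  (forall s t, T t -> T (s + t)%MM) -> is_ideal (support_in T).
Proof.
move=> TM; split; [exact: support_in0|exact: support_inD|move=> a f Tf].
by apply: (@support_inM (fun=> True) T) => // s t _; apply: TM.
Qed.

Lemma ideal_support I f :
  is_ideal I -> support_in (fun t => I 'X_[t]) f -> I f.
Proof.
move=> iI If; rewrite [f]mpolyE; apply: ideal_sum => // t /If.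
exact: idealZ.
Qed.

Lemma support_in_part (c : pred term) T f :
  (forall t, t \in msupp f -> c t -> T t) ->
  support_in T (\sum_(t <- msupp f | c t) f@_t *: 'X_[t]).
Proof.
rewrite big_seq_cond => cT; elim/big_ind: _.
- exact: support_in0.
- exact: support_inD.
- by move=> t /andP[ft ct]; apply: support_inZX; apply: cT.
Qed.

Lemma split_support (b : pred term) f : exists v,
  [/\ support_in (fun t => b t) (f - v), support_in (fun t => ~~ b t) v
    & {subset msupp v <= msupp f}].
Proof.
exists (\sum_(t <- msupp f | ~~ b t) f@_t *: 'X_[t]); split.
- rewrite [X in X - _]mpolyE (bigID b) /= addrK.
  exact: support_in_part.
- exact: support_in_part.
- exact: (@support_in_part _ (fun t => t \in msupp f)).
Qed.

Lemma mem_take_enum_ord d (i : 'I_n) : (i \in take d (enum 'I_n)) = (i < d)%N.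
Proof.
rewrite -(mem_map val_inj) map_take val_enum_ord take_iota mem_iota /=.
by rewrite leq_min ltn_ord andbT.
Qed.

Lemma mem_variables d f :
  f \in variables d -> exists2 i : 'I_n, (i < d)%N & f = 'X_i.
Proof. by case/mapP=> i; rewrite mem_take_enum_ord; exists i. Qed.

Lemma size_variables d : (d <= n)%N -> size (variables d) = d.
Proof. by move=> dn; rewrite size_map size_takel // size_enum_ord. Qed.

Lemma take_variables k d : (k <= d)%N -> take k (variables d) = variables k.
Proof. by move=> kd; rewrite -map_take take_takel. Qed.

Lemma nth_variables d k : (k < d)%N -> (d <= n)%N ->
  exists2 i : 'I_n, i = k :> nat & (variables d)`_k = 'X_i.
Proof.
move=> kd dn; have kn := leq_trans kd dn.
exists (Ordinal kn) => //; rewrite (nth_map (Ordinal kn)).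
  by rewrite nth_take // (nth_ord_enum _ (Ordinal kn)).
by rewrite size_takel // size_enum_ord.
Qed.

Lemma ideal_mpolyX_ge Q (i : 'I_n) b t :
  is_ideal Q -> Q ('X_i ^+ b) -> (b <= t i)%N -> Q 'X_[t].
Proof.
move=> [_ _ QM] Qi bt; have -> : t = (t - U_(i) *+ b + U_(i) *+ b)%MM.
  rewrite submK //; apply/mnm_lepP => j; rewrite mulmnE mnm1E.
  by case: eqP => [<-|]; rewrite ?mul1n ?mul0n.
by rewrite mpolyXD -mpolyXn; apply: QM.
Qed.

(** * Regularity of variables that preserve the normal terms *)

Section Regular.
Variables (I : R -> Prop) (N : term -> Prop) (d : nat).
Hypotheses (iI : is_ideal I) (cN : normal_complement I N).
Hypothesis NU : forall (i : 'I_n) t, (i < d)%N -> N t -> N (U_(i) + t)%MM.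

Lemma support_inXM (i : 'I_n) v : (i < d)%N -> support_in N v ->
  support_in (fun t => N t /\ (0 < t i)%N) ('X_i * v).
Proof.
move=> id; apply: (@support_inM (eq U_(i)%MM) N) => [s t <- Nt|].
  by split; [apply: NU|rewrite mnmDE mnm1E eqxx].
exact: support_inX.
Qed.

(** In a product of ['X_i] by a cofactor, the cofactor can be reduced to terms of [N]; the product
    is then already normal, with all its terms divisible by ['X_i]. *)
Lemma ideal_add_variables k f : (k <= d)%N ->
  ideal_add_seq I (variables k) f <->
  exists v, I (f - v) /\
    support_in (fun t => N t /\ exists2 i : 'I_n, (i < k)%N & (0 < t i)%N) v.
Proof.
move=> kd; have [I0 ID IM] := iI; split.
  case=> s [sS ->]; rewrite big_seq; elim/big_ind: _.
  - by exists 0; rewrite subr0; split=> //; apply: support_in0.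
  - move=> g h [v [Iv Nv]] [w [Iw Nw]]; exists (v + w).
    by split; [rewrite opprD addrACA; apply: ID|apply: support_inD].
  - move=> c /sS[Ic|/mem_variables[i ik ->]].
      by exists 0; rewrite subr0; split; [apply: IM|apply: support_in0].
    have [v [Iv Nv]] := cN.1 c.1; exists ('X_i * v); split.
      by rewrite mulrC -mulrBr; apply: IM.
    move=> t /(support_inXM (leq_trans ik kd) Nv)[Nt ti].
    by split=> //; exists i.
move=> [v [Iv Nv]]; have iQ := ideal_gen_ideal (fun g => I g \/ g \in variables k).
have [_ QD _] := iQ.
rewrite -[f](subrK v); apply: QD; first by apply: mem_ideal_gen; left.
apply: ideal_support => // t /Nv[_ [i ik ti]].
apply: (@ideal_mpolyX_ge _ i 1) => //; apply: mem_ideal_gen; right.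
by apply: map_f; rewrite mem_take_enum_ord.
Qed.

Lemma variables_regular : (d <= n)%N -> N 0%MM -> regular_seq_quo I (variables d).
Proof.
move=> dn N0; have [I0 ID IM] := iI; split; last first.
  case/(ideal_add_variables _ (leqnn d)) => w [Iw Nw].
  have : 1 - w = 0.
    apply: cN.2 => //; apply: support_inB => [t|t /Nw[]//].
    by rewrite msupp1 inE => /eqP->.
  move/eqP; rewrite subr_eq0 => /eqP w1.
  have [|_ [i _]] := Nw 0%MM; first by rewrite -w1 msupp1 inE.
  by rewrite mnm0E.
rewrite size_variables // => k g kd; rewrite take_variables; last exact: ltnW.
have [i ik ->] := nth_variables kd dn.
move=> /(ideal_add_variables _ (ltnW kd))[w [Iw Nw]].
apply/(ideal_add_variables _ (ltnW kd)).
have [v [Iv Nv]] := cN.1 g; exists v; split=> // t tv.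
have id : (i < d)%N by rewrite ik.
(* Being normal, ['X_i * v] is the normal form of ['X_i * g]. Each of its terms [U_(i) + t] involves
   a variable of index below [k = i], which must divide [t]. *)
have vw : 'X_i * v = w.
  apply/eqP; rewrite -subr_eq0; apply/eqP/cN.2.
    rewrite (_ : _ - w = ('X_i * g - w) - 'X_i * (g - v)); last by ring.
    by apply: idealB => //; apply: IM.
  by apply: support_inB => s; [case/(support_inXM id Nv)|case/Nw].
split; first exact: Nv.
have /Nw[_ [j jk]] : (U_(i) + t)%MM \in msupp w.
  by rewrite -vw mulrC mcoeff_msupp mcoeffMX -mcoeff_msupp.
rewrite mnmDE mnm1E; case: eqP => [ij|_]; last by exists j.
by rewrite -ij ik ltnn in jk.
Qed.

End Regular.

Lemma spans_quo_powers Q d b : is_ideal Q ->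
  (forall i : 'I_n, (d <= i)%N -> Q ('X_i ^+ b)) -> spans_quo Q d b.
Proof.
move=> iQ Qb f; pose c t := [exists i : 'I_n, (d <= i)%N && (b <= t i)%N].
have [v [Qv cv sv]] := split_support c f; exists v; split.
  apply: ideal_support => // t /Qv/existsP[i /andP[/Qb Qi bt]].
  exact: ideal_mpolyX_ge Qi bt.
move=> t tv; split; first exact/msize_mdeg_lt/sv.
move=> i di; rewrite ltnNge; apply: contra (cv _ tv) => bt.
by apply/existsP; exists i; rewrite di.
Qed.

Lemma uniform_power Q d : is_ideal Q ->
  (forall i : 'I_n, (d <= i)%N -> exists e, Q ('X_i ^+ e)) ->
  exists b, forall i : 'I_n, (d <= i)%N -> Q ('X_i ^+ b).
Proof.
move=> iQ Qe.
have /fin_all_exists[e eP] : forall i : 'I_n, exists e,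
    (d <= i)%N -> Q ('X_i ^+ e).
  by move=> i; case: (leqP d i) => [/Qe[e]|_]; [exists e|exists 0%N].
exists (\max_i e i)%N => i /eP Qi.
rewrite -(subnK (leq_bigmax i)) exprD.
by case: iQ => _ _; apply.
Qed.

Lemma normal_complement_variables d :
  normal_complement (support_in (fun t => exists2 i : 'I_n, (d <= i)%N & (0 < t i)%N))
    (fun t => forall i : 'I_n, (d <= i)%N -> t i = 0%N).
Proof.
split=> [f|v Tv Nv].
  pose c t := [exists i : 'I_n, (d <= i)%N && (0 < t i)%N].
  have [v [Tv cv _]] := split_support c f; exists v; split.
    by move=> t /Tv/existsP[i /andP[di ti]]; exists i.
  move=> t /cv/existsPn nt i di; apply/eqP; rewrite -leqn0 leqNgt.
  by have := nt i; rewrite di.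
apply/eqP; rewrite -msupp_eq0; case E: (msupp v) => [//|t r].
have tv : t \in msupp v by rewrite E mem_head.
by have [i di] := Tv _ tv; rewrite (Nv _ tv _ di).
Qed.

(** The chain comes from the regular sequence of the first [d] variables modulo the ideal of the
    others, so no ideal of variables has to be shown prime. *)
Lemma variables_prime_chain d : (d <= n)%N -> exists p,
  prime_chain (support_in (fun t => exists2 i : 'I_n, (d <= i)%N & (0 < t i)%N)) d p.
Proof.
move=> dn; set Q := support_in _.
have iQ : is_ideal Q.
  apply: support_in_ideal => s t [i di ti]; exists i => //.
  by rewrite mnmDE ltn_addl.
have /(regular_seq_quoE _ iQ)[rv nv] : regular_seq_quo Q (variables d).
  apply: (variables_regular iQ (normal_complement_variables d)) => //.
    move=> i t id Nt j dj; rewrite mnmDE mnm1E (Nt _ dj) addn0.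
    by case: eqP => // ij; rewrite -ij leqNgt id in dj.
  by move=> i _; rewrite mnm0E.
by have := weakly_regular_prime_chain iQ rv nv; rewrite size_variables.
Qed.

Lemma support_in_degX f k : support_in (fun t => (0 < mdeg t)%N) f ->
  support_in (fun t => (k <= mdeg t)%N) (f ^+ k).
Proof.
move=> f1; elim: k => [//|k IH]; rewrite exprS.
by apply: support_inM f1 IH => s t; rewrite mdegD; lia.
Qed.

End Supports.

(** * Quasi-stable ideals and Pommaret bases *)

Section Pommaret.
Variables (K : fieldType) (n : nat).
Notation R := {mpoly K[n.+1]}.
Notation term := 'X_{1..n.+1}.
Implicit Types (I J : R -> Prop) (P : seq term) (f : R) (s t : term).

Lemma exists_min_var t (j : 'I_n.+1) : (0 < t j)%N ->
  exists2 i, is_min_var t i & (i <= j)%N.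
Proof.
move=> tj; case: (@arg_minnP _ j (fun i => 0 < t i)%N (fun i => i : nat) tj).
by move=> i ti imin; exists i; [split|apply: imin].
Qed.

Lemma monomial_ideal_ideal J : monomial_ideal J -> is_ideal J.
Proof.
move=> [T JT].
have [Q0 QD QM] := ideal_gen_ideal (fun g : R => exists2 s, T s & g = 'X_[s]).
split; first exact/JT.
- by move=> f g /JT Jf /JT Jg; apply/JT/QD.
- by move=> a f /JT Jf; apply/JT/QM.
Qed.

Lemma monomial_ideal_support J f : monomial_ideal J -> J f ->
  support_in (fun t => J 'X_[t]) f.
Proof.
move=> mJ; have [_ _ JM] := monomial_ideal_ideal mJ; have [T JT] := mJ.
move/JT; apply: ideal_gen_min.
  by apply: support_in_ideal => s t Jt; rewrite mpolyXD; apply: JM.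
move=> _ [s Ts ->]; apply: support_inX; apply/JT/mem_ideal_gen.
by exists s.
Qed.

Lemma irrelevant_ideal_support f : irrelevant_ideal f ->
  support_in (fun t => (0 < mdeg t)%N) f.
Proof.
apply: ideal_gen_min => [|_ [i ->]].
  by apply: support_in_ideal => s t; rewrite mdegD; lia.
by apply: support_inX; rewrite mdeg1.
Qed.

(** Trading the smallest variable for a power of ['X_k] lowers the total exponent of the variables
    before ['X_k]; once it is zero, a power of ['X_k] is left. *)
Lemma quasi_stable_push J t (k : 'I_n.+1) : quasi_stable J ->
  (forall i : 'I_n.+1, (0 < t i)%N -> (i <= k)%N) -> J 'X_[t] ->
  exists e, J ('X_k ^+ e).
Proof.
move=> [_ qs]; move: {2}_.+1 (ltnSn (\sum_(i < n.+1 | (i < k)%N) t i)%N) => m.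
elim: m t => // m IH t; rewrite ltnS => le_m tk Jt.
have [/existsP[j /andP[jk tj]]|/existsPn nt] :=
    boolP [exists j : 'I_n.+1, (j < k)%N && (0 < t j)%N].
  have [i mi ij] := exists_min_var tj.
  have ik : (i < k)%N := leq_ltn_trans ij jk.
  have [e Je] := qs t i k Jt mi ik.
  apply: IH Je => [|l].
    apply: leq_trans le_m; rewrite [X in (_ < X)%N](bigD1 i) //= (bigD1 i) //=.
    rewrite mnmDE mnmBE mulmnE !mnm1E eqxx -(inj_eq val_inj) /= gtn_eqF // addn0.
    rewrite -addSn subn1 prednK; last by case: mi.
    rewrite leq_add2l; apply: leq_sum => l /andP[lk li].
    rewrite mnmDE mnmBE mulmnE !mnm1E -!(inj_eq val_inj) /= (gtn_eqF lk) addn0.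
    exact: leq_subr.
  rewrite mnmDE mnmBE mulmnE !mnm1E; case: (k =P l) => [->//|_].
  by rewrite mul0n addn0 => tl; apply/tk/(leq_trans tl)/leq_subr.
exists (t k); rewrite mpolyXn (_ : (U_(k) *+ t k)%MM = t) //.
apply/mnmP => j; rewrite mulmnE mnm1E; case: eqP => [<-|kj]; first by rewrite mul1n.
rewrite mul0n; apply/esym/eqP; rewrite -leqn0 leqNgt; apply/negP => tj.
have := nt j; rewrite tj andbT ltn_neqAle (tk _ tj) andbT negbK.
by rewrite (inj_eq val_inj) => /eqP jk; apply: kj.
Qed.

(** Descent from [n.+1], where the first clause is vacuous, to the least such [D]; the form
    [i.+1 = D] makes the second clause vacuous at [D = 0]. *)
Lemma exists_power_threshold J : exists2 D, (D <= n.+1)%N &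
  (forall i : 'I_n.+1, (D <= i)%N -> exists e, J ('X_i ^+ e)) /\
  (forall i : 'I_n.+1, i.+1 = D -> forall e, ~ J ('X_i ^+ e)).
Proof.
pose good m := forall i : 'I_n.+1, (m <= i)%N -> exists e, J ('X_i ^+ e).
suff gP m : (m <= n.+1)%N -> good m -> exists2 D, (D <= n.+1)%N &
    good D /\ (forall i : 'I_n.+1, i.+1 = D -> forall e, ~ J ('X_i ^+ e)).
  by apply: (gP n.+1) => // i; rewrite leqNgt ltn_ord.
elim: m => [|m IH] lem gm; first by exists 0%N.
case: (classic (good m)) => [|ngm]; first exact/IH/ltnW.
exists m.+1 => //; split=> // i [im] e Je; apply: ngm => j.
rewrite leq_eqVlt => /orP[/eqP mj|]; last exact: gm.
by exists e; rewrite (_ : j = i) //; apply: val_inj; rewrite /= im.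
Qed.

(** Otherwise the Pommaret divisor [r] of [s - U_(i)] gives a second decomposition: [i] is still
    multiplicative for [r], being minimal in [s], which [r] divides. *)
Lemma pommaret_min_var J P s (i : 'I_n.+1) : pommaret_basis J P -> s \in P ->
  is_min_var s i -> ~ J 'X_[s - U_(i)].
Proof.
move=> [JP JU] sP [si imin] Ju.
have [r [d [rP udr dr]]] : exists r d, [/\ r \in P, (s - U_(i) = d + r)%MM
    & max_le_min d r].
  have [uP|nuP] := boolP ((s - U_(i))%MM \in P).
    by exists (s - U_(i))%MM, 0%MM; rewrite add0m; split=> // a b; rewrite mnm0E.
  by have [r [[rP [d [ud dr]]] _]] := JU _ Ju nuP; exists r, d.
have sE : s = (d + r + U_(i))%MM.
  by rewrite -udr submK //; apply/mnm_lepP => j; rewrite mnm1E; case: eqP => // <-.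
(* Uniqueness is available only outside [P], so [s] is multiplied by a power of the smallest
   variable, multiplicative for every term, that exceeds all degrees in [P]. *)
pose k := (\sum_(q <- P) mdeg q).+1; pose t := (U_(ord0) *+ k + s)%MM.
have tP : t \notin P.
  apply/negP => tP.
  suff : (mdeg t <= \sum_(q <- P) mdeg q)%N.
    by rewrite mdegD mdegMn mdeg1 mul1n /k; lia.
  by rewrite (big_rem t) //= leq_addr.
have Jt : J 'X_[t].
  apply/JP; rewrite mpolyXD.
  have [_ _ GM] := ideal_gen_ideal (fun g : R => exists2 s, s \in P & g = 'X_[s]).
  by apply: GM; apply: mem_ideal_gen; exists s.
have [q [_ qU]] := JU _ Jt tP.
have qs : q = s.
  apply: qU; split=> //; exists (U_(ord0) *+ k)%MM; split=> // a b.
  by rewrite mulmnE mnm1E; case: eqP => // <-.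
have qr : q = r.
  apply: qU; split=> //; exists (U_(ord0) *+ k + (d + U_(i)))%MM; split.
    by rewrite /t {1}sE -!addmA [(r + U_(i))%MM]addmC.
  move=> a b; rewrite !mnmDE mulmnE !mnm1E; case: (ord0 =P a) => [<-//|_].
  rewrite mul0n add0n addn_gt0 => /orP[da rb|]; first exact: dr.
  case: (i =P a) => // <- _ rb; apply: imin.
  by rewrite sE !mnmDE -addnA addnCA ltn_addr.
have := congr1 (fun m : term => mdeg m) sE; rewrite -qs qr !mdegD mdeg1; lia.
Qed.

(** The annihilator in R/J of the class of ['X_[s - U_(i)]] contains ['X_i] and, by quasi-stability,
    powers of all later variables, so the module it generates has growth order at most [i]. *)
Lemma regular_seq_le_min_var J P s (i : 'I_n.+1) fs :
  quasi_stable J -> pommaret_basis J P -> s \in P -> is_min_var s i ->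
  (forall f, f \in fs -> irrelevant_ideal f) -> regular_seq_quo J fs ->
  (size fs <= i)%N.
Proof.
move=> [mJ qs] pJ sP mi fs_irr; have iJ := monomial_ideal_ideal mJ.
have Ju := pommaret_min_var pJ sP mi; set u := (s - U_(i))%MM in Ju.
move=> /(regular_seq_quoE _ iJ)[rfs _]; pose k := (mdeg u).+1.
have Js : J 'X_[s] by apply/pJ.1/mem_ideal_gen; exists s.
(* Passing to powers of degree larger than deg u keeps X^u nonzero modulo the
   whole sequence, so X^u generates a submodule on which the sequence acts as a
   chain of nonzerodivisors. *)
have /(weakly_regular_nzd_chain iJ (weakly_regular_pow k iJ rfs)) cfs :
    ~ foldl (@ideal_add R) J [seq f ^+ k | f <- fs] 'X_[u].
  pose T t := J 'X_[t] \/ (k <= mdeg t)%N.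
  move=> Fu; have : support_in T ('X_[u] : R).
    apply: foldl_ideal_add_min Fu => [|g Jg t gt|_ /mapP[f /fs_irr fi ->] t ft].
    - apply: support_in_ideal => a b [Jb|kb]; last by right; rewrite mdegD; lia.
      by left; rewrite mpolyXD; case: iJ => _ _; apply.
    - by left; apply: (monomial_ideal_support mJ Jg).
    - by right; apply: support_in_degX (irrelevant_ideal_support fi) _ ft.
  by case/(_ u); rewrite ?msuppX ?inE // /k ltnn.
rewrite -(size_map (fun f => f ^+ k)).
have iQ := ideal_colon_ideal 'X_[u] iJ.
have [l|b Qb] := @uniform_power _ _ (ideal_colon J 'X_[u]) i iQ.
  rewrite leq_eqVlt => /orP[/eqP/val_inj <-|il].
    exists 1%N; rewrite /ideal_colon -mpolyXD addmC submK //.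
    by apply/mnm_lepP => j; rewrite mnm1E; case: eqP => // <-; case: mi.
  have [e Je] := qs s i l Js mi il; exists e.
  by rewrite /ideal_colon mpolyXn mulrC -mpolyXD.
exact: nzd_chain_bound iQ (spans_quo_powers iQ Qb) cfs.
Qed.

(** In a decomposition [d + s] of [U_(i) + t] with [s] in [P], the factor ['X_i] can only come from
    [d], and cancelling it leaves [t] in [J]. *)
Lemma normal_terms_addU J P (i : 'I_n.+1) t : is_ideal J -> pommaret_basis J P ->
  (forall s, s \in P -> s i = 0%N) -> ~ J 'X_[t] -> ~ J 'X_[U_(i) + t].
Proof.
move=> [_ _ JM] [JP JU] Pi nJt Jt.
have [itP|/(JU _ Jt)[s [[sP [d [td _]]] _]]] := boolP ((U_(i) + t)%MM \in P).
  by have := Pi _ itP; rewrite mnmDE mnm1E eqxx.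
have ti := congr1 (fun m : term => m i) td.
rewrite !mnmDE mnm1E eqxx (Pi _ sP) addn0 /= in ti.
apply: nJt; have -> : t = (d - U_(i) + s)%MM.
  apply/mnmP => j; have := congr1 (fun m : term => m j) td.
  by rewrite !mnmDE mnmBE mnm1E; case: eqP => [<-|_] /=; lia.
by rewrite mpolyXD; apply/JM/JP/mem_ideal_gen; exists s.
Qed.

(** * Transfer of normal forms to the ideal of a marked basis *)

Section MarkedBasis.
Variables (J I : R -> Prop) (P : seq term) (h : term -> R).
Hypotheses (homI : homogeneous_ideal I) (mb : marked_basis J P h).
Hypothesis Ih : forall f, I f <-> marked_ideal P h f.

(** Reducing each homogeneous component separately gives the degree control that [spans_quo]
    demands. *)
Lemma marked_basis_reduce f : exists v, I (f - v) /\
  support_in (fun t => (mdeg t < msize f)%N /\ ~ J 'X_[t]) v.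
Proof.
have iI := homI.1.
have /fin_all_exists[v vP] : forall d : 'I_(msize f), exists v,
    I (pihomog mdeg d f - v) /\ normal_span J d v.
  move=> d; have [u [v [_ uI vN fE]]] := (mb.2 d).1 _ (pihomogP mdeg d f).
  by exists v; rewrite fE addrK; split=> //; apply/Ih.
exists (\sum_d v d); split.
  rewrite {1}(pihomog_partitionE (mf := mdeg) (leqnn (msize f))) -sumrB.
  by apply: ideal_sum => // d _; case: (vP d).
elim/big_ind: _ => [||d _ t /((vP d).2)[-> nJ]].
- exact: support_in0.
- exact: support_inD.
- by split.
Qed.

Lemma marked_basis_normal_complement :
  normal_complement I (fun t => ~ J 'X_[t]).
Proof.
split=> [f|v Iv Nv].
  have [v [Iv Nv]] := marked_basis_reduce f; exists v; split=> // t.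
  by case/Nv.
rewrite (pihomog_partitionE (mf := mdeg) (leqnn (msize v))) big1 // => d _.
apply: (mb.2 d).2; first exact: pihomogP.
- by apply/Ih/homI.2.
- by apply: support_in_part => t /Nv nJ /eqP.
Qed.

Lemma marked_basis_spans d b : is_ideal J ->
  (forall i : 'I_n.+1, (d <= i)%N -> J ('X_i ^+ b)) -> spans_quo I d b.
Proof.
move=> iJ Jb f; have [v [Iv Nv]] := marked_basis_reduce f.
exists v; split=> // t /Nv[tf nJ]; split=> // i /Jb Ji.
by rewrite ltnNge; apply/negP => bt; apply/nJ/(ideal_mpolyX_ge iJ Ji bt).
Qed.

End MarkedBasis.

(** A term of [J] in the variables before index [D] alone could be pushed onto the last of them,
    giving an excluded power. *)
Lemma quasi_stable_large_var J D t : quasi_stable J -> ~ J 1 ->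
  (forall i : 'I_n.+1, i.+1 = D -> forall e, ~ J ('X_i ^+ e)) -> (D <= n.+1)%N ->
  J 'X_[t] -> exists2 i : 'I_n.+1, (D <= i)%N & (0 < t i)%N.
Proof.
move=> qsJ nJ1 nJX Dn Jt; apply: NNPP => nt.
have tD (i : 'I_n.+1) : (0 < t i)%N -> (i < D)%N.
  by move=> ti; rewrite ltnNge; apply/negP => Di; apply: nt; exists i.
case: D {nt} nJX Dn tD => [|k] nJX Dn tD.
  apply: nJ1; rewrite -mpolyX0 (_ : 0%MM = t) //; apply/mnmP => i.
  by rewrite mnm0E; case: (posnP (t i)) => // /tD.
have [//|e] := @quasi_stable_push J t (Ordinal Dn) qsJ _ Jt.
exact: nJX.
Qed.

End Pommaret.

Theorem theorem3p3 (K : fieldType) (n : nat) (J I : {mpoly K[n.+1]} -> Prop)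
    (P : seq 'X_{1..n.+1}) (h : 'X_{1..n.+1} -> {mpoly K[n.+1]})
    (hJ : quasi_stable J) (hP : pommaret_basis J P)
    (hI : homogeneous_ideal I) (hh : marked_basis J P h)
    (hIh : forall f : {mpoly K[n.+1]}, I f <-> marked_ideal P h f) :
  cohen_macaulay J -> cohen_macaulay I.
Proof.
have iJ := monomial_ideal_ideal hJ.1; have iI := hI.1.
have cI := marked_basis_normal_complement hI hh hIh.
case: (classic (J 1)) => [J1 _|nJ1].
  (* When [J] is the whole ring no term is normal, so 1 reduces to 0 and lies in [I]. *)
  have [_ _ JM] := iJ; left; have [v [Iv Nv]] := cI.1 1.
  suff v0 : v = 0 by move: Iv; rewrite v0 subr0.
  apply/eqP; rewrite -msupp_eq0; case E: (msupp v) => [//|t r].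
  by case: (Nv t); rewrite ?E ?mem_head // -['X_[t]]mulr1; apply: JM.
case=> // -[d [[[fs [fs_irr rfs sfs]] _] [_ maxd]]]; right.
have [D Dn [Je nJX]] := exists_power_threshold J.
have [b Jb] := uniform_power iJ Je.
(* [J] lies in the ideal of the variables from [D] on, over which there is a chain of primes of
   length [D]. *)
have leDd : (D <= d)%N.
  have [p cp] := variables_prime_chain K Dn.
  apply: (maxd D p); split=> [i li|]; last exact: cp.2.
  have [pi Qp] := cp.1 i li; split=> // f Jf; apply: Qp => t ft.
  apply: (quasi_stable_large_var hJ nJ1 nJX Dn).
  exact: (monomial_ideal_support hJ.1 Jf).
(* If [j < D] occurred in [s], its smallest variable would satisfy [i <= j < D <= d], while the
   regular sequence of length [d] forces [d <= i]. *)
have PD s (j : 'I_n.+1) : s \in P -> (j < D)%N -> s j = 0%N.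
  move=> sP jD; case: (posnP (s j)) => // /exists_min_var[i mi ij].
  have := regular_seq_le_min_var hJ hP sP mi fs_irr rfs.
  rewrite sfs => di.
  by have := leq_trans jD (leq_trans leDd (leq_trans di ij)); rewrite ltnn.
have rX : regular_seq_quo I (variables K n.+1 D).
  apply: (variables_regular iI cI) => // [i t iD|].
    by apply: normal_terms_addU iJ hP _ => s sP; apply: PD.
  by rewrite mpolyX0.
have spI := marked_basis_spans hI hh hIh iJ Jb.
(* The variables before [D] attain both depth and dimension, and [spI] bounds both from above. *)
exists D; split; split.
- exists (variables K n.+1 D); split=> //; last exact: size_variables.
  by move=> _ /mem_variables[i _ ->]; apply: mem_ideal_gen; exists i.
- by move=> gs _; apply: regular_seq_bound iI spI.
- have [wX nX] := (regular_seq_quoE _ iI).1 rX.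
  by have := weakly_regular_prime_chain iI wX nX; rewrite size_variables.
- by move=> e p; apply: prime_chain_bound spI.
Qed.
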